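(* Let $P,\psi_0,\dot\psi_0,u_0,\dot u_0$ be toric Cauchy data as in the context, and let $\psi(s,x)=(u_0+s\dot u_0)^\star(x)=\sup_{y\in P}\big(\langle x,y\rangle-u_0(y)-s\dot u_0(y)\big)$ for $(s,x)\in\mathbb R_+\times\mathbb R^n$. Let $T>0$. Then $$\int_{[0,T]\times\mathbb R^n}\mathrm{MA}\,\psi\ \le\ \mathrm{Vol}\,\Big(\operatorname{epi}(-\dot u_0)\setminus\operatorname{epi}\big(-(\dot u_0)^{\star\star}\big)\Big),$$ where the right hand side denotes the volume in $\mathbb R^{n+1}$ of the set of points lying below the graph of $\dot u_0$ and above the graph of its convexification $(\dot u_0)^{\star\star}$, over $P$.
   Context: Toric Cauchy data. $(M,\omega)$ is a toric Kähler manifold of complex dimension $n$, with Delzant moment polytope $P=\{y\in\mathbb R^n: l_k(y)\ge 0,\ k=1,\dots,d\}$, where $l_k(y)=\langle y,v_k\rangle-\lambda_k$ are the affine functions defining the facets (inward primitive normals $v_k$; exactly $n$ facets meet at each vertex and their normals form a lattice basis). $\psi_0:\mathbb R^n\to\mathbb R$ is the open-orbit Kähler potential, in logarithmic coordinates, of an $(S^1)^n$-invariant Kähler metric in the class of $\omega$: it is smooth with positive definite Hessian, and $\nabla\psi_0$ is a diffeomorphism of $\mathbb R^n$ onto the interior $P\setminus\partial P$. $\dot\psi_0$ is the restriction to the open orbit of a smooth $(S^1)^n$-invariant function on $M$. Set $u_0:=\psi_0^\star$ (Legendre-Fenchel dual, a function on $P$) and $\dot u_0:=-\dot\psi_0\circ(\nabla\psi_0)^{-1}$,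 which extends to an element of $C^\infty(P)$ (smooth up to the boundary). By Guillemin, $u_0=\sum_{k=1}^d l_k\log l_k+F$ with $F\in C^\infty(P)$ (up to the normalization of the $l_k$), and $u_0$ is smooth with positive definite Hessian on the interior of $P$ and on the relative interior of each face. For a function $f$ on $P$, $\operatorname{epi} f:=\{(y,r): y\in P,\ r\ge f(y)\}$, and $f^{\star\star}$ is its biconjugate (convexification), i.e. the largest convex function on $P$ that is $\le f$. For a convex function $f$, $\mathrm{MA}\,f$ is the Borel measure $(\mathrm{MA}\,f)(E)=$ Lebesgue measure of $\partial f(E)=\bigcup_{p\in E}\partial f(p)$, with $\partial f$ the subdifferential. The formula for $\psi$ defines a finite convex function of $(s,x)\in\mathbb R\times\mathbb R^n$, and subgradients of $\psi$ at points $(0,x)$ are understood for this function. *)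

(* Defs.v *)
From HB Require Import structures.
From mathcomp Require Import all_boot all_order all_algebra.
From mathcomp Require Import all_classical all_reals all_analysis.

Set Implicit Arguments.
Unset Strict Implicit.
Unset Printing Implicit Defensive.

Import Order.TTheory GRing.Theory Num.Theory.
Import numFieldNormedType.Exports.

Local Open Scope classical_set_scope.
Local Open Scope ring_scope.

Definition dot (R : realType) (n : nat) (x y : 'rV[R]_n) : R :=
  \sum_(i < n) x 0 i * y 0 i.

(* [U] is meant to be open and [V] finite-dimensional: existence and continuity
   of the iterated directional derivatives of order at most [k] is then the
   usual C^k. *)
Fixpoint Ck_in (R : realType) (V W : normedModType R) (U : set V) (k : nat)
    (f : V -> W) : Prop :=
  {in U, continuous f} /\
  match k with
  | 0%N => True
  | k'.+1 => forall v : V,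
      {in U, forall x, derivable f x v} /\ Ck_in U k' (fun x => 'D_v f x)
  end.

Definition smooth_in (R : realType) (V W : normedModType R) (U : set V)
    (f : V -> W) : Prop :=
  forall k, Ck_in U k f.

(* C^oo(A), smoothness up to the boundary, for a closed [A]. *)
Definition smooth_up_to (R : realType) (V W : normedModType R) (A : set V)
    (f : V -> W) : Prop :=
  exists (U : set V) (g : V -> W),
    [/\ open U, A `<=` U, smooth_in U g & {in A, f =1 g}].

Definition grad (R : realType) (n : nat) (f : 'rV[R]_n -> R) (x : 'rV[R]_n) :
    'rV[R]_n :=
  \row_(i < n) 'D_(delta_mx 0 i) f x.

Definition posdef_hessian (R : realType) (n : nat) (f : 'rV[R]_n -> R) : Prop :=
  forall x v : 'rV[R]_n, v != 0 -> 0 < 'D_v (fun w => 'D_v f w) x.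

Definition diffeo_onto (R : realType) (n : nat) (U : set 'rV[R]_n)
    (F : 'rV[R]_n -> 'rV[R]_n) : Prop :=
  [/\ set_bij setT U F, smooth_in setT F &
      exists2 G : 'rV[R]_n -> 'rV[R]_n, cancel F G & smooth_in U G].

Section Convex.
Variable R : realType.
Local Open Scope ereal_scope.

Definition legendre (n : nat) (A : set 'rV[R]_n) (f : 'rV[R]_n -> \bar R)
    (x : 'rV[R]_n) : \bar R :=
  ereal_sup [set (dot x y)%:E - f y | y in A].

(* For [f] on [A]: [f^**], which is again a function of the primal variable. *)
Definition biconjugate (n : nat) (A : set 'rV[R]_n) (f : 'rV[R]_n -> \bar R) :
    'rV[R]_n -> \bar R :=
  legendre setT (legendre A f).

Definition subdiff (m : nat) (f : 'rV[R]_m -> \bar R) (p : 'rV[R]_m) :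
    set 'rV[R]_m :=
  [set q | f p \is a fin_num /\
           forall p', f p + (dot q (p' - p)%R)%:E <= f p'].

(* Points of R x R^n are written [row_mx s x : 'rV_(1 + n)], scalar first. *)
Definition hd (n : nat) (z : 'rV[R]_(1 + n)) : R := lsubmx z ord0 ord0.
Definition tl (n : nat) (z : 'rV[R]_(1 + n)) : 'rV[R]_n := rsubmx z.

Definition epi (n : nat) (A : set 'rV[R]_n) (f : 'rV[R]_n -> \bar R) :
    set 'rV[R]_(1 + n) :=
  [set z | A (tl z) /\ f (tl z) <= (hd z)%:E].

Definition box (m : nat) (a b : 'rV[R]_m) : set 'rV[R]_m :=
  [set x | forall i, (a ord0 i <= x ord0 i < b ord0 i)%R].

(* Lebesgue outer measure on R^(m+1), which is Lebesgue measure on Lebesgue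
   measurable sets. *)
Definition volume (m : nat) (A : set 'rV[R]_m.+1) : \bar R :=
  ereal_inf [set t | exists a b : nat -> 'rV[R]_m.+1,
    [/\ forall k i, (a k ord0 i <= b k ord0 i)%R,
        A `<=` \bigcup_k box (a k) (b k) &
        t = \sum_(0 <= k <oo) (\prod_i (b k ord0 i - a k ord0 i))%:E]].

Definition MA (m : nat) (f : 'rV[R]_m.+1 -> \bar R) (E : set 'rV[R]_m.+1) :
    \bar R :=
  volume (\bigcup_(p in E) subdiff f p).

End Convex.

Section Toric.
Variables (R : realType) (n d : nat).
Variables (v : 'I_d -> 'rV[int]_n) (lambda : 'I_d -> R).

Definition normal (k : 'I_d) : 'rV[R]_n := map_mx intr (v k).

Definition ell (k : 'I_d) (y : 'rV[R]_n) : R := dot y (normal k) - lambda k.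

Definition polytope : set 'rV[R]_n := [set y | forall k, 0 <= ell k y].

Definition vertex (p : 'rV[R]_n) : Prop :=
  polytope p /\
  forall (y z : 'rV[R]_n) (t : R), polytope y -> polytope z -> 0 < t < 1 ->
    p = t *: y + (1 - t) *: z -> y = p /\ z = p.

(* [f] enumerates, without repetition, the facets through [p]. *)
Definition facets_at (p : 'rV[R]_n) (f : 'I_n -> 'I_d) : Prop :=
  injective f /\ forall k, ell k p = 0 <-> exists i, f i = k.

Record delzant : Prop := Delzant {
  delzant_bounded : bounded_set polytope ;
  delzant_full_dim : polytope° !=set0 ;
  delzant_facet : forall k, exists y,
    ell k y = 0 /\ forall j, j != k -> 0 < ell j y ;
  delzant_primitive : forall k (a : int) (w : 'rV[int]_n),
    v k = a *: w -> `|a|%N = 1%N ;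
  delzant_vertex : forall p, vertex p -> exists f,
    facets_at p f /\ (\matrix_(i < n) v (f i)) \in unitmx }.

(* The toric manifold with polytope [polytope] is covered by affine charts C^n,
   one for each vertex [p].  If [f] enumerates the facets at [p] and [e_i] is
   the basis dual to the normals [v (f i)], the chart coordinates are the
   characters z_i of weight e_i.  The logarithmic coordinate of a point of the
   open orbit {z_1 ... z_n <> 0} is x = c log|w|^2, for w the standard
   coordinates of the torus, i.e. <x, e_i> = c log|z_i|^2, i.e.
   x = sum_i (c log|z_i|^2) v_(f i).
   Take c = 1 for x = log|w|^2 (so that u_0 = sum_k l_k log l_k + F), c = 1/2
   for x = log|w|.
   A point z = a + ib of C^n is the pair (a, b). *)
Definition sqmod (z : 'rV[R]_n * 'rV[R]_n) (i : 'I_n) : R :=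
  z.1 0 i ^+ 2 + z.2 0 i ^+ 2.

Definition open_orbit : set ('rV[R]_n * 'rV[R]_n) :=
  [set z | forall i, sqmod z i != 0].

Definition chart_log (c : R) (f : 'I_n -> 'I_d) (z : 'rV[R]_n * 'rV[R]_n) :
    'rV[R]_n :=
  \sum_(i < n) (c * ln (sqmod z i)) *: normal (f i).

Definition mulJ (w : 'rV[R]_n * 'rV[R]_n) : 'rV[R]_n * 'rV[R]_n :=
  (- w.2, w.1).

(* Positivity of the complex Hessian: the sum of second derivatives below is
   four times the Levi form of [phi] at [z] in the direction [w]. *)
Definition strictly_psh (phi : 'rV[R]_n * 'rV[R]_n -> R) : Prop :=
  forall z w : 'rV[R]_n * 'rV[R]_n, w != 0 ->
    0 < 'D_w (fun z' => 'D_w phi z') z +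
        'D_(mulJ w) (fun z' => 'D_(mulJ w) phi z') z.

(* i ddbar psi0 extends from the open orbit to a Kaehler form, in the class
   determined by the polytope: in the chart at [p], psi0 - <x, p> (which differs
   from psi0 by a pluriharmonic function) extends to a smooth strictly
   plurisubharmonic function on C^n. *)
Definition kaehler_potential (c : R) (psi0 : 'rV[R]_n -> R) : Prop :=
  forall p f, vertex p -> facets_at p f ->
    exists phi : 'rV[R]_n * 'rV[R]_n -> R,
      [/\ smooth_in setT phi, strictly_psh phi &
          forall z, open_orbit z ->
            phi z = psi0 (chart_log c f z) - dot (chart_log c f z) p].

Definition smooth_on_toric_manifold (c : R) (g : 'rV[R]_n -> R) : Prop :=
  forall p f, vertex p -> facets_at p f ->
    exists eta : 'rV[R]_n * 'rV[R]_n -> R,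
      smooth_in setT eta /\
      forall z, open_orbit z -> eta z = g (chart_log c f z).

Record toric_cauchy_data (c : R) (psi0 psidot0 udot0 : 'rV[R]_n -> R) : Prop :=
  ToricCauchyData {
    tcd_delzant : delzant ;
    tcd_scale : 0 < c ;
    tcd_psi0_smooth : smooth_in setT psi0 ;
    tcd_psi0_hessian : posdef_hessian psi0 ;
    tcd_psi0_grad : diffeo_onto polytope° (grad psi0) ;
    tcd_psi0_kaehler : kaehler_potential c psi0 ;
    tcd_psidot0 : smooth_on_toric_manifold c psidot0 ;
    (* udot0 is the extension to the polytope of - psidot0 o (grad psi0)^-1 *)
    tcd_udot0_smooth : smooth_up_to polytope udot0 ;
    tcd_udot0 : forall x, udot0 (grad psi0 x) = - psidot0 x }.

(* Extended-real valued, so that no finiteness on the boundary is built in. *)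
Definition symplectic_potential (psi0 : 'rV[R]_n -> R) : 'rV[R]_n -> \bar R :=
  legendre setT (EFin \o psi0).

Definition legendre_flow (psi0 udot0 : 'rV[R]_n -> R) (s : R) (x : 'rV[R]_n) :
    \bar R :=
  legendre polytope
    (fun y => symplectic_potential psi0 y + (s * udot0 y)%:E)%E x.

End Toric.

(* Main.v *)
Require Import Defs.
From HB Require Import structures.
From mathcomp Require Import all_boot all_order all_algebra.
From mathcomp Require Import all_classical all_reals all_analysis.
From mathcomp Require Import ring lra.

(* Let [(r, q)] be a subgradient of [psi] at [(s, x)].  Testing the subgradient
   inequality at [(s, x - v_k)] gives [q \in P], and testing it at
   [(s + 1, x + x')] gives [udot^**(q) <= - r].  If [q] is interior, say
   [q = grad psi0 x0], testing it at [(0, x0)] gives [- r <= udot(q)] when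
   [s > 0]; for [s = 0] the test points are [(- e, x0)] with [e] tending to [0].
   Hence [(r, q)] lies in the set on the right-hand side, unless [q] lies on a
   facet or [- r = udot^**(q)].  The two exceptional sets are null: the first is
   contained in finitely many hyperplanes, and the convex function [udot^**] is
   Lipschitz at positive distance from the boundary of [P]. *)

Set Implicit Arguments.
Unset Strict Implicit.
Unset Printing Implicit Defensive.

Import Order.TTheory GRing.Theory Num.Theory.
Import numFieldNormedType.Exports.

Local Open Scope classical_set_scope.
Local Open Scope ring_scope.

(** * Outer volume and null sets *)

Section Volume.
Variables (R : realType) (m : nat).
Implicit Types (A B : set 'rV[R]_m.+1) (a b : 'rV[R]_m.+1).

Let bvol a b : R := \prod_i (b ord0 i - a ord0 i).

Let bvol_ge0 a b : (forall i, a ord0 i <= b ord0 i) -> 0 <= bvol a b.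
Proof. by move=> ab; apply: prodr_ge0 => i _; rewrite subr_ge0. Qed.

Lemma volume_ge0 A : (0 <= volume A)%E.
Proof.
apply: le_ereal_inf_tmp => _ [a [b [ab _ ->]]].
by apply: nneseries_ge0 => k _ _; rewrite lee_fin; exact: bvol_ge0.
Qed.

Lemma volume_mono A B : A `<=` B -> (volume A <= volume B)%E.
Proof.
move=> AB; apply: le_ereal_inf_tmp => _ [a [b [ab cB ->]]].
by apply: ereal_inf_lbound; exists a, b; split => //; exact: subset_trans cB.
Qed.

Lemma volume_countably_subadditive (A : nat -> set 'rV[R]_m.+1) :
  (volume (\bigcup_i A i) <= \sum_(i <oo) volume (A i))%E.
Proof.
have [[i ioo]|] := pselect (exists i, volume (A i) = +oo%E).
  rewrite (eseries_pinfty _ _ ioo) ?leey// => k _.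
  by rewrite -ltNye (lt_le_trans _ (volume_ge0 _)).
rewrite -forallNE => Aoo.
apply/lee_addgt0Pr => e e0.
apply: le_trans (epsilon_trick _ _ (ltW e0)); last by move=> ?; exact: volume_ge0.
have /choice[G GP] : forall i, exists G : nat -> 'rV[R]_m.+1 * 'rV[R]_m.+1,
    [/\ forall k j, (G k).1 ord0 j <= (G k).2 ord0 j,
        A i `<=` \bigcup_k box (G k).1 (G k).2 &
        (\sum_(0 <= k <oo) (bvol (G k).1 (G k).2)%:E <=
         volume (A i) + (e / (2 ^ i.+1)%:R)%:E)%E].
  move=> i.
  have e1 : 0 < e / (2 ^ i.+1)%:R by rewrite divr_gt0// ltr0n expn_gt0.
  have fA : volume (A i) \is a fin_num.
    by rewrite ge0_fin_numE ?volume_ge0// ltey; apply/eqP; exact: Aoo.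
  have [_ [a [b [ab cA ->]]] /ltW le] := lb_ereal_inf_adherent e1 fA.
  by exists (fun k => (a k, b k)).
pose w p := (bvol (G p.1 p.2).1 (G p.1 p.2).2)%:E.
have w0 p : (0 <= w p)%E.
  by rewrite lee_fin; apply: bvol_ge0; case: (GP p.1).
(* A bijection of [nat] with [nat * nat] merges the covers of all the [A i] into one sequence of
   boxes. *)
have /card_esym/ppcard_eqP[f] := card_nat2.
apply: (@le_trans _ _ (\sum_(0 <= k <oo) w (f k))%E).
  apply: ereal_inf_lbound.
  exists (fun k => (G (f k).1 (f k).2).1), (fun k => (G (f k).1 (f k).2).2).
  split => [k i||//]; first by case: (GP (f k).1).
  move=> x [i _ Aix]; have [_ /(_ _ Aix)[j _ xj] _] := GP i.
  by exists (f^-1%FUN (i, j)) => //=; rewrite invK ?inE.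
rewrite nneseries_esumT//.
rewrite -(@reindex_esum _ _ _ setT setT f w); last first.
  exact: (@bij _ _ setT setT f).
have -> : [set: nat * nat] = [set: nat] `*`` (fun=> [set: nat]).
  by apply/seteqP; split.
rewrite -(@esum_esum _ _ _ setT (fun=> setT) (fun i j => w (i, j)))//.
rewrite -nneseries_esumT; last by move=> i; exact: esum_ge0.
apply: lee_nneseries => [i _ _|i _]; first exact: esum_ge0.
by rewrite -nneseries_esumT//; case: (GP i).
Qed.

Lemma volume_bigcup0 (N : nat -> set 'rV[R]_m.+1) :
  (forall i, volume (N i) = 0%E) -> volume (\bigcup_i N i) = 0%E.
Proof.
move=> N0; apply/eqP; rewrite eq_le volume_ge0 andbT.
by apply: le_trans (volume_countably_subadditive _) _; rewrite eseries0.
Qed.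

Lemma volume_setU_null A N : volume N = 0%E -> (volume (A `|` N) <= volume A)%E.
Proof.
move=> N0; pose F i := if i is 0%N then A else N.
have -> : A `|` N = \bigcup_i F i.
  apply/seteqP; split=> [x [Ax|Nx]|x [[|i] _ Fx]]; [|by exists 1%N|by left|by right].
  by exists 0%N.
apply: le_trans (volume_countably_subadditive _) _.
rewrite nneseries_recl//=; last by move=> k _; exact: volume_ge0.
by rewrite eseries0 ?adde0// => -[].
Qed.

Lemma volume_finite_cover (I : finType) (a b : I -> 'rV[R]_m.+1) A :
  (forall k i, a k ord0 i <= b k ord0 i) ->
  (forall x, A x -> exists k, box (a k) (b k) x) ->
  (volume A <= (\sum_k \prod_i (b k ord0 i - a k ord0 i))%:E)%E.
Proof.
move=> ab cA.
(* The finite cover is padded to a sequence: beyond [#|I|] both corners are 0, and such a box has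
   volume zero because there is at least one coordinate. *)
pose ext (c : I -> 'rV[R]_m.+1) (k : nat) :=
  if insub k : option 'I_#|I| is Some i then c (enum_val i) else 0.
have extab k i : ext a k ord0 i <= ext b k ord0 i.
  by rewrite /ext; case: insubP.
have ext_ord c (k : 'I_#|I|) : ext c k = c (enum_val k) by rewrite /ext valK.
apply: (@le_trans _ _ (\sum_(0 <= k <oo) (bvol (ext a k) (ext b k))%:E)%E).
  apply: ereal_inf_lbound; exists (ext a), (ext b); split => // x /cA[k xk].
  by exists (enum_rank k) => //; rewrite !ext_ord enum_rankK.
rewrite (nneseries_split 0 #|I|); last first.
  by move=> k _; rewrite lee_fin; exact: bvol_ge0.
rewrite eseries0 => [|k + _]; last first.
  rewrite add0n leqNgt => /negPf ki.
  rewrite /ext insubF// /bvol big_ord_recl subrr mul0r//.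
rewrite adde0 add0n sumEFin lee_fin big_mkord.
under eq_bigr do rewrite !ext_ord.
by rewrite [leRHS](reindex (@enum_val I predT))//=; exact/onW_bij/enum_val_bij.
Qed.

End Volume.

(** * Lipschitz graphs are null sets *)

Section LipschitzNull.
Variables (R : realType) (m : nat) (i : 'I_m.+1) (L : R).
Hypothesis L0 : 0 <= L.

(** Such an [A] is a graph over its projection along coordinate [i], [L]-Lipschitz for the sup norm;
    [h] stands in for the maximum over the other coordinates. *)
Definition lipschitz_coord (A : set 'rV[R]_m.+1) :=
  forall (z z' : 'rV[R]_m.+1) (h : R), 0 < h -> A z -> A z' ->
    (forall j, j != i -> `|z ord0 j - z' ord0 j| <= h) ->
    `|z ord0 i - z' ord0 i| <= L * h.

(** Cut the other [m] coordinates into [N.+1 ^ m] cells of side [h = 2 * M / N.+1]. Over each cell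
    [A] fits into a box of height [2 * (L + 1) * h], so the total volume is [K / N.+1], which tends
    to 0. *)
Lemma volume_bounded_lipschitz_coord (A : set 'rV[R]_m.+1) (M : R) :
  (forall z j, A z -> `|z ord0 j| < M) -> lipschitz_coord A -> volume A = 0%E.
Proof.
move=> AM AL; apply/eqP; rewrite eq_le volume_ge0 andbT.
have [M0|M0] := leP M 0.
  apply: le_trans (@volume_finite_cover _ _ void (fun=> 0) (fun=> 0) _ _ _) _.
  - by [].
  - by move=> x /(AM _ ord0) /(le_lt_trans (normr_ge0 _)); rewrite ltNge M0.
  - by rewrite lee_fin big1 => [|[]].
pose K := (2 * M) ^+ m * (2 * (L + 1) * (2 * M)).
have L0' := L0; have M20 : 0 < 2 * M by lra.
have L20 : 0 < 2 * (L + 1) by lra.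
have K0 : 0 < K by apply: mulr_gt0; [exact: exprn_gt0|exact: mulr_gt0].
suff le_K N : (volume A <= (K / N.+1%:R)%:E)%E.
  apply/lee_addgt0Pr => e e0; rewrite add0e.
  apply: le_trans (le_K (Num.truncn (K / e))) _.
  rewrite lee_fin ler_pdivrMr ?ltr0n// mulrC -ler_pdivrMr//.
  by apply/ltW/truncnS_gt.
pose h : R := 2 * M / N.+1%:R.
have h0 : 0 < h by rewrite divr_gt0 ?ltr0n.
pose lo (f : {ffun 'I_m -> 'I_N.+1}) j : R := - M + (f j)%:R * h.
pose cell f (z : 'rV[R]_m.+1) := forall j, lo f j <= z ord0 (lift i j) < lo f j + h.
(* [w f] is a reference point of [A] over the cell [f], or 0 when there is none. *)
have /choice[w wP] : forall f, exists w, forall z, A z -> cell f z -> A w /\ cell f w.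
  move=> f; have [[w Aw]|nw] := pselect (exists w, A w /\ cell f w).
    by exists w.
  by exists 0 => z Az cz; case: nw; exists z.
(* The half-height uses [L + 1] instead of [L] because boxes are half-open and the upper inequality
   must be strict. *)
pose a f : 'rV[R]_m.+1 := \row_j
  if unlift i j is Some k then lo f k else w f ord0 i - (L + 1) * h.
pose b f : 'rV[R]_m.+1 := \row_j
  if unlift i j is Some k then lo f k + h else w f ord0 i + (L + 1) * h.
have Lh0 : 0 < (L + 1) * h by rewrite mulr_gt0//; lra.
apply: le_trans (@volume_finite_cover _ _ _ a b _ _ _) _.
- by move=> f j; rewrite !mxE; case: unlift => [k|]; lra.
- move=> z Az.
  pose t j : R := (z ord0 (lift i j) + M) / h.
  have t0 j : 0 <= t j.
    by rewrite divr_ge0 ?(ltW h0)//; have := AM _ (lift i j) Az; rewrite ltr_norml; lra.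
  have tN j : (Num.truncn (t j) < N.+1)%N.
    rewrite truncn_lt_nat// ltr_pdivrMr// /h mulrC divfK ?pnatr_eq0//.
    by have := AM _ (lift i j) Az; rewrite ltr_norml; lra.
  pose f := [ffun j => Ordinal (tN j)].
  have cz : cell f z.
    move=> j; have /andP[] := truncn_itv (t0 j); rewrite /lo ffunE /=.
    rewrite ler_pdivlMr// ltr_pdivrMr// -natr1 => ? ?.
    by apply/andP; split; lra.
  have [Aw cw] := wP _ _ Az cz.
  exists f => j; rewrite !mxE; case: unliftP => [k ->//|->].
  have : `|z ord0 i - w f ord0 i| <= L * h.
    apply: AL => // l; case: (unliftP i l) => [k ->|->]; last by rewrite eqxx.
    rewrite ler_norml.
    by have := cz k; have := cw k; lra.
  by rewrite ler_norml; lra.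
- rewrite lee_fin (eq_bigr (fun=> h ^+ m * (2 * ((L + 1) * h)))); last first.
    move=> f _; rewrite (bigD1_ord i)//= !mxE unlift_none.
    rewrite (eq_bigr (fun=> h)) => [|j _]; last by rewrite !mxE liftK; ring.
    by rewrite prodr_const card_ord; ring.
  rewrite sumr_const card_ffun !card_ord -[leLHS]mulr_natl natrX mulrA -exprMn /h.
  rewrite [N.+1%:R * _]mulrC divfK ?pnatr_eq0// /K le_eqVlt; apply/orP; left; apply/eqP.
  by field; rewrite nat1r pnatr_eq0.
Qed.

Lemma volume_lipschitz_coord (A : set 'rV[R]_m.+1) :
  lipschitz_coord A -> volume A = 0%E.
Proof.
move=> AL.
have -> : A = \bigcup_k (A `&` [set z | forall j, `|z ord0 j| < k%:R]).
  apply/seteqP; split=> [z Az|z [k _ []]//].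
  exists (Num.truncn (\sum_j `|z ord0 j|)).+1 => //; split => // j.
  apply: le_lt_trans (truncnS_gt _); rewrite (bigD1 j)//= lerDl.
  exact: sumr_ge0.
apply: volume_bigcup0 => k.
apply: (@volume_bounded_lipschitz_coord _ k%:R) => [z j []//|].
by move=> z z' h h0 [Az _] [Az' _]; exact: AL.
Qed.

End LipschitzNull.

(** * Convexity from a positive definite Hessian *)

Section ConvexLine.
Variable R : realType.

(** The mean value theorem is used twice: for [f1], to see that it is nondecreasing, and for [f],
    whose slope between [a] and [b] is a value of [f1] in between. *)
Lemma tangent_line_le (f f1 f2 : R -> R) :
  (forall t : R, is_derive t (1 : R) f (f1 t)) ->
  (forall t : R, is_derive t (1 : R) f1 (f2 t)) ->
  (forall t, 0 <= f2 t) -> forall a b, f a + f1 a * (b - a) <= f b.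
Proof.
move=> df df1 f2_ge0.
have mvt (g g1 : R -> R) (a b : R) : (forall t : R, is_derive t (1 : R) g (g1 t)) ->
    a <= b -> exists2 c, a <= c <= b & g b - g a = g1 c * (b - a).
  move=> dg ab.
  have cg : {within `[a, b], continuous g}.
    by apply: derivable_within_continuous => t _; exact: ex_derive.
  have [c + E] := MVT_segment ab (fun t _ => dg t) cg.
  by rewrite in_itv/= => cab; exists c.
have f1_nd a b : a <= b -> f1 a <= f1 b.
  move=> ab; have [c _ E] := mvt _ _ _ _ df1 ab.
  by rewrite -subr_ge0 E mulr_ge0// subr_ge0.
move=> a b; have [ab|/ltW ba] := leP a b.
  have [c /andP[ac _] E] := mvt _ _ _ _ df ab.
  have := f1_nd _ _ ac; have : 0 <= b - a by rewrite subr_ge0.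
  by rewrite -subr_ge0; nra.
have [c /andP[_ ca] E] := mvt _ _ _ _ df ba.
by have := f1_nd _ _ ca; nra.
Qed.

Lemma is_derive_line (V : normedModType R) (f : V -> R) (x v : V) (t : R) :
  derivable f (t *: v + x) v ->
  is_derive t (1 : R) (fun u : R => f (u *: v + x)) ('D_v f (t *: v + x)).
Proof.
have E : (fun h : R => h^-1 *: (((fun u : R => f (u *: v + x)) \o shift t) (h *: (1 : R))
             - f (t *: v + x)))
       = (fun h : R => h^-1 *: ((f \o shift (t *: v + x)) (h *: v) - f (t *: v + x))).
  by apply/funext => h /=; rewrite [h *: 1]mulr1 scalerDl addrA.
by move=> fv; split; rewrite /derivable /derive E.
Qed.

End ConvexLine.

Section Gradient.
Variables (R : realType) (n : nat) (f : 'rV[R]_n -> R).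
Hypotheses (fs : smooth_in setT f) (fH : posdef_hessian f).

Lemma smooth_derivable x v : derivable f x v.
Proof. by have [_ /(_ v)[+ _]] := fs 1%N; apply; rewrite inE. Qed.

Lemma smooth_derive_continuous v : continuous (fun x => 'D_v f x).
Proof.
by move=> x; have [_ /(_ v)[_ [+ _]]] := fs 1%N; apply; rewrite inE.
Qed.

Lemma smooth_derive_derivable x v : derivable (fun y => 'D_v f y) x v.
Proof. by have [_ /(_ v)[_ [_ /(_ v)[+ _]]]] := fs 2%N; apply; rewrite inE. Qed.

Lemma tangent_direction_le x v (a b : R) :
  f (a *: v + x) + 'D_v f (a *: v + x) * (b - a) <= f (b *: v + x).
Proof.
apply: (@tangent_line_le R (fun u => f (u *: v + x)) (fun u => 'D_v f (u *: v + x))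
  (fun u => 'D_v (fun y => 'D_v f y) (u *: v + x))).
- by move=> t; apply: is_derive_line; exact: smooth_derivable.
- move=> t; apply: (@is_derive_line R _ (fun y => 'D_v f y)).
  exact: smooth_derive_derivable.
(* Positivity of the Hessian covers [v != 0] only; in the direction 0 all difference quotients
   vanish. *)
- move=> t; have [->|v0] := eqVneq v 0; last exact/ltW/fH.
  rewrite (_ : 'D_0 _ _ = 0)// /derive (_ : (fun h => _) = cst 0) ?lim_cst//.
  by apply/funext => h /=; rewrite scaler0 add0r subrr scaler0.
Qed.

(** Add the tangent inequalities from parameter [t] to 1 and to 0 with weights [t] and [1 - t]; the
    derivative terms cancel. *)
Lemma chord_le x v (t : R) : 0 <= t <= 1 -> f (t *: v + x) - f x <= t * (f (v + x) - f x).
Proof.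
move=> /andP[t0 t1].
have := tangent_direction_le x v t 0; have := tangent_direction_le x v t 1.
rewrite scale0r !add0r scale1r => /(ler_wpM2l t0) H1.
have t1' : 0 <= 1 - t by rewrite subr_ge0.
by move=> /(ler_wpM2l t1'); lra.
Qed.

(* [smooth_in] does not say that ['D_w f x] is linear in [w]: the inequality is
   obtained by moving from [x] to [x + t w] one coordinate at a time and letting
   [t] tend to [0]. *)
Lemma gradient_le x w : f x + dot (grad f x) w <= f (x + w).
Proof.
pose p (t : R) k : 'rV[R]_n :=
  t *: (\sum_(i < n | (i < k)%N) w ord0 i *: delta_mx 0 i) + x.
pose G t := \sum_(k < n) 'D_(delta_mx 0 k) f (p t k) * w ord0 k.
have pS t (k : 'I_n) : p t k.+1 = (t * w ord0 k) *: delta_mx 0 k + p t k.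
  rewrite /p (bigD1 k)//= scalerDr scalerA -addrA; congr (_ + (_ *: _ + _)).
  by apply: eq_bigl => i; rewrite ltnS ltn_neqAle andbC.
have p0 k : p 0 k = x by rewrite /p scale0r add0r.
have pn t : p t n = t *: w + x.
  congr (_ *: _ + _); rewrite [RHS]row_sum_delta.
  by apply: eq_bigl => i; rewrite ltn_ord.
have pt0 t : p t 0%N = x by rewrite /p big_pred0 ?scaler0 ?add0r.
have stepG t : t * G t <= f (t *: w + x) - f x.
  rewrite -(pn t) -(pt0 t) -(telescope_sumr (fun k => f (p t k)))// big_mkord.
  rewrite mulr_sumr; apply: ler_sum => k _; rewrite pS.
  have := tangent_direction_le (p t k) (delta_mx 0 k) 0 (t * w ord0 k).
  by rewrite scale0r add0r; nra.
(* By convexity on the segment from [x] to [x + w], the increment that bounds [t * G t] is at most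
   [t * (f (x + w) - f x)]; divide by [t]. *)
have Gle : \forall t \near 0^'+, G t <= f (x + w) - f x.
  near=> t; have t0 : 0 < t by [].
  rewrite -(ler_pM2l t0) (le_trans (stepG t))// [x + w]addrC chord_le//.
  by rewrite ltW//=; near: t; exact: nbhs_right_le.
have cG : G t @[t --> 0^'+] --> G 0.
  apply: cvg_at_right_filter; apply: cvg_big => [|k _]; first exact: add_continuous.
  apply: cvgMr_tmp.
  apply: (@continuous_comp _ _ _ (fun t => p t k) (fun y => 'D_(delta_mx 0 k) f y)).
    by apply: cvgD; [exact: scalel_continuous|exact: cvg_cst].
  exact: smooth_derive_continuous.
have -> : dot (grad f x) w = G 0.
  by apply: eq_bigr => k _; rewrite p0 mxE.
by rewrite addrC -lerBrDr; exact: cvgr_to_le cG Gle.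
Unshelve. all: by end_near.
Qed.

Lemma partial_derivative_le x i (e : R) : 0 < e ->
  \forall t \near (0 : R), f (t *: delta_mx 0 i + x) - f x <=
    t * grad f x ord0 i + e * `|t|.
Proof.
move=> e0; have /cvgrPdist_lt := @smooth_derivable x (delta_mx 0 i).
move=> /(_ _ e0).
rewrite near_withinE => H; near=> t.
have [->|t0] := eqVneq t 0.
  by rewrite scale0r add0r subrr mul0r normr0 mulr0 addr0.
have : t != 0 -> `|grad f x ord0 i - t^-1 * (f (t *: delta_mx 0 i + x) - f x)| < e.
  by rewrite mxE; near: t; exact: H.
move=> /(_ t0)/ltW; rewrite -(ler_pM2r (_ : 0 < `|t|)) ?normr_gt0// -normrM.
rewrite mulrBl [X in _ - X]mulrAC mulVf// mul1r ler_norml => /andP[+ _].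
by rewrite mulrC; lra.
Unshelve. all: by end_near.
Qed.
End Gradient.

(** * The Legendre flow *)

Section Dot.
Variables (R : realType) (n : nat).
Implicit Types x y z : 'rV[R]_n.

Lemma dotC x y : dot x y = dot y x.
Proof. by apply: eq_bigr => i _; rewrite mulrC. Qed.

Lemma dotDr x y z : dot x (y + z) = dot x y + dot x z.
Proof. by rewrite -big_split; apply: eq_bigr => i _; rewrite mxE mulrDr. Qed.

Lemma dotZr x a y : dot x (a *: y) = a * dot x y.
Proof. by rewrite mulr_sumr; apply: eq_bigr => i _; rewrite mxE; ring. Qed.

Lemma dotBr x y z : dot x (y - z) = dot x y - dot x z.
Proof. by rewrite dotDr -scaleN1r dotZr mulN1r. Qed.

Lemma dotDl x y z : dot (x + y) z = dot x z + dot y z.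
Proof. by rewrite ![dot _ z]dotC dotDr. Qed.

Lemma dotZl a x y : dot (a *: x) y = a * dot x y.
Proof. by rewrite ![dot _ y]dotC dotZr. Qed.

Lemma dotBl x y z : dot (x - y) z = dot x z - dot y z.
Proof. by rewrite ![dot _ z]dotC dotBr. Qed.

Lemma dot_delta i y : dot (delta_mx 0 i) y = y ord0 i.
Proof.
rewrite /dot (bigD1 i)//= mxE !eqxx mul1r big1 ?addr0// => j /negPf ji.
by rewrite mxE ji andbF mul0r.
Qed.

Lemma dot_row_mx (a b : 'rV[R]_(1 + n)) :
  dot a b = hd a * hd b + dot (tl a) (tl b).
Proof.
rewrite {1}/dot big_split_ord big_ord1 /hd /tl /dot !mxE /=.
by congr (_ + _); apply: eq_bigr => i _; rewrite !mxE.
Qed.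

Lemma hd_row_mx (s : R) x : hd (row_mx s%:M x) = s.
Proof. by rewrite /hd row_mxKl mxE eqxx. Qed.

Lemma tl_row_mx (s : R) x : tl (row_mx s%:M x) = x.
Proof. exact: row_mxKr. Qed.

Lemma hdB (a b : 'rV[R]_(1 + n)) : hd (a - b) = hd a - hd b.
Proof. by rewrite /hd !mxE. Qed.

Lemma tlB (a b : 'rV[R]_(1 + n)) : tl (a - b) = tl a - tl b.
Proof. by apply/rowP => i; rewrite !mxE. Qed.

End Dot.

Section Legendre.
Variables (R : realType) (n : nat) (A : set 'rV[R]_n).
Local Open Scope ereal_scope.

Lemma legendre_ub (f : 'rV[R]_n -> \bar R) x y :
  A y -> (dot x y)%:E - f y <= legendre A f x.
Proof. by move=> Ay; apply: ereal_sup_ubound; exists y. Qed.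

Lemma legendre_le (f : 'rV[R]_n -> \bar R) x M :
  (forall y, A y -> (dot x y)%:E - f y <= M) -> legendre A f x <= M.
Proof. by move=> H; apply: ge_ereal_sup => _ [y Ay <-]; exact: H. Qed.

End Legendre.

Section Potential.
Variables (R : realType) (n : nat) (f : 'rV[R]_n -> R).

Lemma symplectic_potential_ge x y :
  ((dot y x - f x)%:E <= symplectic_potential f y)%E.
Proof. by rewrite EFinB; exact: legendre_ub. Qed.

Lemma symplectic_potential_grad x :
  smooth_in setT f -> posdef_hessian f ->
  symplectic_potential f (grad f x) = (dot (grad f x) x - f x)%:E.
Proof.
move=> fs fH; apply/eqP; rewrite eq_le symplectic_potential_ge andbT.
apply: legendre_le => y _; rewrite -EFinB lee_fin.
have := gradient_le fs fH x (y - x); rewrite subrKC dotBr; lra.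
Qed.

End Potential.

Section Flow.
Variables (R : realType) (n : nat) (P : set 'rV[R]_n).
Variables (u : 'rV[R]_n -> \bar R) (g : 'rV[R]_n -> R).

(** [legendre_flow] is, by conversion, the case where [P] is the polytope and [u] the symplectic
    potential. *)
Definition flow (s : R) (x : 'rV[R]_n) : \bar R :=
  legendre P (fun y => u y + (s * g y)%:E)%E x.

Lemma flow_shift s x s' x' (F C : R) : (flow s x <= F%:E)%E ->
  (forall y, P y -> dot (x' - x) y - (s' - s) * g y <= C) ->
  (flow s' x' <= (F + C)%:E)%E.
Proof.
move=> sxF H; apply: legendre_le => y Py.
have := le_trans (legendre_ub _ x Py) sxF; have := H _ Py.
rewrite dotBl; case: (u y) => [r| |].
- by rewrite !lee_fin; lra.
- rewrite !addye//=. by move=> _ _; rewrite addeNy leNye.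
- rewrite !addNye /=. by rewrite addey// leye_eq.
Qed.

Lemma subdiff_flow z Q :
  subdiff (fun z => flow (hd z) (tl z)) z Q ->
  exists F, flow (hd z) (tl z) = F%:E /\
   forall s x, ((F + hd Q * (s - hd z) + dot (tl Q) (x - tl z))%:E <= flow s x)%E.
Proof.
move=> [/fineK <- H]; eexists; split; first reflexivity.
move=> s x; have := H (row_mx s%:M x).
by rewrite hd_row_mx tl_row_mx dot_row_mx hdB tlB hd_row_mx tl_row_mx -EFinD addrA.
Qed.

End Flow.

(** * Bounds on the subgradients of the flow *)

Section FlowBounds.
Variables (R : realType) (n : nat) (P : set 'rV[R]_n) (g : 'rV[R]_n -> R).

(** Moving by [(1, x)] raises the flow by at most the Legendre transform of [g] at [x], so
    [hd Q + dot (tl Q) x] is bounded by that transform; take the supremum over [x]. *)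
Lemma subdiff_flow_biconjugate_le (u : 'rV[R]_n -> \bar R) z Q :
  subdiff (fun z => flow P u g (hd z) (tl z)) z Q ->
  (biconjugate P (EFin \o g) (tl Q) <= (- hd Q)%:E)%E.
Proof.
move=> /subdiff_flow[F [zF H]]; apply: legendre_le => x _.
have zF' : (flow P u g (hd z) (tl z) <= F%:E)%E by rewrite zF.
have bound C : (legendre P (EFin \o g) x <= C%:E)%E -> hd Q + dot (tl Q) x <= C.
  move=> xC; have : (flow P u g (hd z + 1) (tl z + x) <= (F + C)%:E)%E.
    apply: flow_shift zF' _ => y Py.
    rewrite ![_ + _ - _]addrAC !subrr !add0r mul1r -lee_fin EFinB.
    exact: le_trans (legendre_ub _ x Py) xC.
  move=> /(le_trans (H _ _)).
  by rewrite ![_ + _ - _]addrAC !subrr !add0r lee_fin; lra.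
case: legendre bound => [r| |] /= bound.
- by rewrite lee_fin; have := bound r (lexx _); lra.
- by rewrite addeNy leNye.
(* If the transform were [-oo], every real [C] would be admissible, in particular one below the
   left-hand side. *)
- have := bound (hd Q + dot (tl Q) x - 1); rewrite leNye => /(_ isT).
  by rewrite lerBrDl gerDr ler10.
Qed.

Variable f : 'rV[R]_n -> R.
Hypotheses (fs : smooth_in setT f) (fH : posdef_hessian f).
Let u := symplectic_potential f.

(** The Fenchel-Young inequality bounds [u y] below by [dot y x - f x], and [x] may be chosen
    separately for each [y]. *)
Lemma flow_potential_le s x0 C :
  (forall y, P y -> exists x, dot x0 y - (dot y x - f x) - s * g y <= C) ->
  (flow P u g s x0 <= C%:E)%E.
Proof.
move=> H; apply: legendre_le => y Py; have [x le] := H _ Py.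
have := symplectic_potential_ge f x y; rewrite -/u.
case: (u y) => [r| |].
- by rewrite !lee_fin => ?; rewrite (le_trans _ le)//; lra.
- by rewrite addye//= addeNy leNye.
- by rewrite leeNy_eq.
Qed.

(** The value of the flow at [z] is at least its term at [y = grad f x0], where [u] is known
    exactly. Inserted into the subgradient inequality at [(s, x0)], this cancels all terms in
    [tl z]. *)
Lemma subdiff_flow_ge (x0 : 'rV[R]_n) z Q : P (grad f x0) -> tl Q = grad f x0 ->
  subdiff (fun z => flow P u g (hd z) (tl z)) z Q ->
  forall s, ((f x0 + hd Q * (s - hd z) - hd z * g (grad f x0))%:E <= flow P u g s x0)%E.
Proof.
move=> Pq Qq /subdiff_flow[F [zF H]] s; apply: le_trans (H s x0).
have := legendre_ub (fun y => u y + (hd z * g y)%:E)%E (tl z) Pq.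
rewrite -/(flow P u g (hd z) (tl z)) zF /u symplectic_potential_grad// Qq.
by rewrite !lee_fin dotBr [dot (tl z) _]dotC; lra.
Qed.

Lemma subdiff_flow_pos x0 z Q : P (grad f x0) -> tl Q = grad f x0 -> 0 < hd z ->
  subdiff (fun z => flow P u g (hd z) (tl z)) z Q -> - hd Q <= g (grad f x0).
Proof.
move=> Pq Qq z0 /(subdiff_flow_ge Pq Qq)/(_ 0)/le_trans => H.
have /H : (flow P u g 0 x0 <= (f x0)%:E)%E.
  apply: flow_potential_le => y _; exists x0.
  by rewrite dotC mul0r; lra.
by rewrite lee_fin; nra.
Qed.

(* With [q] the gradient of [f] at [x0], the deficit
   [f x0 + u y - <x0, y>] is at least [delta * tau / 2] for [y] at distance at
   least [delta] from [q], so for small [e > 0] the supremum defining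
   [flow (- e) x0] only feels the values of [g] near [q]. *)
Lemma subdiff_flow_zero x0 z Q (M : R) : P (grad f x0) -> tl Q = grad f x0 ->
  hd z = 0 -> (forall y, P y -> g y <= M) ->
  (forall e, 0 < e -> exists2 delta, 0 < delta & forall y, P y ->
    (forall i, `|y ord0 i - grad f x0 ord0 i| < delta) ->
    g y <= g (grad f x0) + e) ->
  subdiff (fun z => flow P u g (hd z) (tl z)) z Q -> - hd Q <= g (grad f x0).
Proof.
move=> Pq Qq z0 gM gusc /(subdiff_flow_ge Pq Qq); rewrite z0 => H.
set q := grad f x0 in Pq Qq gusc H *.
apply/ler_addgt0Pr => eta eta0; have [d d0 gd] := gusc _ eta0.
have d20 : 0 < d / 2 by rewrite divr_gt0.
pose close i := [set t : R |
  f (t *: delta_mx 0 i + x0) - f x0 <= t * q ord0 i + d / 2 * `|t|].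
have [r /= r0 Hr] : \forall t \near (0 : R), forall i, close i t.
  apply: (@filter_forall _ _ close (nbhs (0 : R))) => i.
  exact: partial_derivative_le.
pose tau := r / 2; have tau0 : 0 < tau by rewrite divr_gt0.
have {}Hr t i : `|t| = tau ->
    f (t *: delta_mx 0 i + x0) - f x0 <= t * q ord0 i + d / 2 * tau.
  move=> tt; rewrite -[in leRHS]tt; apply: Hr.
  by rewrite /ball_/= sub0r normrN tt /tau; lra.
(* [N] is positive and bounds [M - g q]. With [e * N = d / 2 * tau], the deficit of [d / 2 * tau]
   away from [q] absorbs the possible gain [e * (M - g q)]. *)
pose N := `|M - g q| + 1.
have N0 : 0 < N by rewrite ltr_wpDl.
pose e := d / 2 * tau / N.
have e0 : 0 < e by rewrite divr_gt0// mulr_gt0.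
have eN : e * N = d / 2 * tau by rewrite divfK// gt_eqF.
have : (flow P u g (- e) x0 <= (f x0 + e * (g q + eta))%:E)%E.
  apply: flow_potential_le => y Py.
  have [near|/existsNP[i /negP]] :=
    pselect (forall i, `|y ord0 i - q ord0 i| < d).
    by exists x0; have := gd _ Py near; rewrite [dot y _]dotC; nra.
  rewrite -leNgt => far.
  (* Step from [x0] along a coordinate in which [y] is far from [q], with the sign that makes the
     linear gain [tau] times the distance. *)
  pose t := tau * Num.sg (y ord0 i - q ord0 i).
  have tE : t * (y ord0 i - q ord0 i) = tau * `|y ord0 i - q ord0 i|.
    by rewrite /t -mulrA -normrEsg.
  have tt : `|t| = tau.
    rewrite /t normrM normr_sg gtr0_norm// -normr_gt0 (lt_le_trans d0 far).
    by rewrite mulr1.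
  exists (t *: delta_mx 0 i + x0).
  rewrite dotDr dotZr [dot y (delta_mx _ _)]dotC dot_delta [dot y x0]dotC.
  have := Hr _ i tt; have := gM _ Py.
  have Ngq : M - g q <= N by rewrite /N ler_wpDr// ler_norm.
  have : tau * d <= tau * `|y ord0 i - q ord0 i| by rewrite ler_pM2l.
  nra.
move=> /(le_trans (H (- e))); rewrite lee_fin => le.
by rewrite -(ler_pM2l e0); lra.
Qed.

End FlowBounds.

(** * The biconjugate *)

Section Biconjugate.
Variables (R : realType) (n : nat).

Lemma legendre_convex (A : set 'rV[R]_n) (w : 'rV[R]_n -> \bar R) x x' (a b r r' : R) :
  0 <= a -> 0 <= b -> a + b = 1 ->
  (legendre A w x <= r%:E)%E -> (legendre A w x' <= r'%:E)%E ->
  (legendre A w (a *: x + b *: x') <= (a * r + b * r')%:E)%E.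
Proof.
move=> a0 b0 ab xr xr'; apply: legendre_le => y Ay.
have := le_trans (legendre_ub w x Ay) xr; have := le_trans (legendre_ub w x' Ay) xr'.
case: (w y) => [c| |].
- rewrite !lee_fin dotDl !dotZl => /(ler_wpM2l b0) H /(ler_wpM2l a0) H'.
  have : a * c + b * c = c by rewrite -mulrDl ab mul1r.
  by lra.
- by move=> *; rewrite addeNy leNye.
- by rewrite addey// leye_eq.
Qed.

Variables (P : set 'rV[R]_n) (g : 'rV[R]_n -> R) (M : R).
Hypothesis gM : forall y, P y -> `|g y| <= M.
Let G := biconjugate P (EFin \o g).

(** The lower bound comes from the term at 0 in the outer supremum, the upper one from [G <= g] on
    [P]. *)
Lemma biconjugate_bounds y : P y -> ((- M)%:E <= G y <= M%:E)%E.
Proof.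
move=> Py; apply/andP; split.
  have : (legendre P (EFin \o g) 0%R <= M%:E)%E.
    apply: legendre_le => x Px; rewrite lee_fin -(scale0r x) dotZl mul0r.
    by have := gM Px; rewrite ler_norml; lra.
  rewrite -leeN2 EFinN => /le_trans; apply.
  have := @legendre_ub R n setT (legendre P (EFin \o g)) y 0%R I.
  by rewrite -{1}(scale0r y) dotZr mul0r add0e.
apply: legendre_le => x _; have := legendre_ub (EFin \o g) x Py.
have := gM Py; rewrite ler_norml dotC.
case: legendre => [c| |].
- by rewrite !lee_fin; lra.
- by move=> *; rewrite addeNy leNye.
- by rewrite leeNy_eq.
Qed.

(** Points whose closed sup-norm ball of radius [d] lies in [P]: there a bounded convex function has
    a uniform Lipschitz constant. *)
Definition erosion (d : R) : set 'rV[R]_n :=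
  [set y | forall y' : 'rV[R]_n, (forall i, `|y' ord0 i - y ord0 i| <= d) -> P y'].

Lemma erosion_sub d : 0 <= d -> erosion d `<=` P.
Proof. by move=> d0 y; apply => i; rewrite subrr normr0. Qed.

Lemma biconjugate_erosion_lipschitz d h y y' r r' : 0 < d -> 0 < h ->
  erosion d y -> erosion d y' -> (forall i, `|y ord0 i - y' ord0 i| <= h) ->
  G y = r%:E -> G y' = r'%:E -> `|r - r'| <= 2 * M / d * h.
Proof.
move=> d0 h0.
wlog suff: y y' r r' / erosion d y -> erosion d y' ->
    (forall i, `|y ord0 i - y' ord0 i| <= h) ->
    G y = r%:E -> G y' = r'%:E -> r - r' <= 2 * M / d * h.
  move=> H Py Py' yy' Gy Gy'; rewrite ler_norml.
  have y'y i : `|y' ord0 i - y ord0 i| <= h by rewrite distrC.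
  have := H _ _ _ _ Py Py' yy' Gy Gy'; have := H _ _ _ _ Py' Py y'y Gy' Gy.
  by lra.
move=> Py Py' yy' Gy Gy'.
(* Prolong the segment from [y'] past [y] by at most [d], which stays in [P]. Then [y] is a convex
   combination of [y2] and [y'], and the bound [M] at [y2] controls [G y]. *)
pose y2 := y + (d / h) *: (y - y').
have Py2 : P y2.
  apply: Py => i; rewrite !mxE addrAC subrr add0r normrM gtr0_norm ?divr_gt0//.
  by rewrite mulrAC ler_pdivrMr// ler_pM2l.
have Py'' := erosion_sub (ltW d0) Py'.
have /andP[_ G2] := biconjugate_bounds Py2.
have := biconjugate_bounds Py''; rewrite Gy' !lee_fin => /andP[r'M _].
have hd0 : 0 < h + d by rewrite addr_gt0.
have yE : y = (h / (h + d)) *: y2 + (d / (h + d)) *: y'.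
  apply/rowP => i; rewrite !mxE; field.
  by rewrite !gt_eqF.
have : (G y <= (h / (h + d) * M + d / (h + d) * r')%:E)%E.
  rewrite yE; apply: legendre_convex.
  - by apply: divr_ge0; exact: ltW.
  - by apply: divr_ge0; exact: ltW.
  - by rewrite -mulrDl divff ?gt_eqF.
  - exact: G2.
  - by rewrite -Gy'.
rewrite Gy lee_fin => le.
have -> : 2 * M / d * h = h / d * (2 * M) by ring.
have M0 : 0 <= M by exact: le_trans (normr_ge0 _) (gM Py'').
apply: (@le_trans _ _ (h / (h + d) * (2 * M))).
  have : d / (h + d) = 1 - h / (h + d) by field; rewrite gt_eqF.
  have : 0 <= h / (h + d) by rewrite divr_ge0 ?ltW.
  by nra.
rewrite ler_wpM2r ?mulr_ge0// ler_wpM2l ?(ltW h0)// lef_pV2 ?posrE//.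
by rewrite lerDr ltW.
Qed.

Lemma volume_biconjugate_graph_erosion d : 0 < d ->
  volume [set z : 'rV[R]_(1 + n) | erosion d (tl z) /\ G (tl z) = (- hd z)%:E] = 0%E.
Proof.
(* A negative [M] forces [P] to be empty; otherwise [2 * M / d] is a legitimate Lipschitz
   constant. *)
move=> d0; have [M0|M0] := leP 0 M; last first.
  rewrite (_ : [set z | _] = set0).
    have := @volume_bounded_lipschitz_coord R n ord0 0 (lexx 0) set0 0.
    by apply => // ? [].
  rewrite -subset0 => z [/(erosion_sub (ltW d0))/gM].
  by move=> /(le_trans (normr_ge0 _)); rewrite leNgt M0.
have L0 : 0 <= 2 * M / d by apply: divr_ge0 (ltW d0); exact: mulr_ge0.
refine (@volume_lipschitz_coord R n (lshift n (@ord0 0)) _ L0 _ _).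
move=> z z' h h0 [Pz Gz] [Pz' Gz'] zz'.
have := biconjugate_erosion_lipschitz d0 h0 Pz Pz' _ Gz Gz'.
rewrite opprK addrC /hd !mxE distrC; apply => i.
by rewrite !mxE; apply: zz'; exact: (negbT (@eq_rlshift 1 n i ord0)).
Qed.

End Biconjugate.

(** * The polytope *)

Section Polytope.
Variables (R : realType) (n d : nat).
Variables (v : 'I_d -> 'rV[int]_n) (lambda : 'I_d -> R).
Let P := polytope v lambda.

Lemma ell_continuous k : continuous (ell v lambda k).
Proof.
move=> y.
have cdot : continuous (fun y' : 'rV[R]_n => dot y' (normal R v k)).
  apply: continuous_big => [|i _ y']; first exact: add_continuous.
  have cc := @coord_continuous R 1 n 0 i y'.
  exact: (@cvgMr_tmp _ _ (nbhs y') (nbhs_filter y') _ _ _ cc).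
exact: (cvgB (cdot y) (cvg_cst (lambda k))).
Qed.

Lemma polytope_closed : closed P.
Proof.
have -> : P = \bigcap_(k in setT) (ell v lambda k @^-1` [set t | 0 <= t]).
  by apply/seteqP; split=> [y Py k _|y Py k]; [exact: Py|exact: Py].
apply: closed_bigI => k _; apply: (continuous_closedP _).1; last exact: closed_ge.
exact: ell_continuous.
Qed.

Lemma polytope_interior y : (forall k, 0 < ell v lambda k y) -> P° y.
Proof.
move=> y0; pose pos k := [set t | 0 < ell v lambda k t].
have : \forall t \near y, forall k, pos k t.
  apply: (@filter_forall _ _ pos (nbhs y)) => k.
  exact: (@cvgr_gt _ _ _ (nbhs_filter y) _ _ (@ell_continuous k y) _ (y0 k)).
by apply: filterS => t yt k; exact/ltW/yt.
Qed.

(** Solving the equation for a coordinate [j] with nonzero coefficient exhibits the hyperplane as a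
    Lipschitz graph; [rshift 1 j] is its index once the scalar comes first. *)
Lemma volume_facet_cylinder k : v k != 0 ->
  volume [set z : 'rV[R]_(1 + n) | ell v lambda k (tl z) = 0] = 0%E.
Proof.
move=> /rV0Pn[j vj]; pose w := normal R v k.
have wj : w ord0 j != 0 by rewrite mxE intr_eq0.
pose L := (\sum_(i < n) `|w ord0 i|) / `|w ord0 j|.
have L0 : 0 <= L by rewrite divr_ge0// sumr_ge0.
refine (@volume_lipschitz_coord R n (rshift 1 j) L L0 _ _).
move=> z z' h h0 Hz Hz' zz'.
have H : dot (tl z - tl z') w = 0.
  by move: Hz Hz'; rewrite /= /ell -/w dotBl; lra.
rewrite /L mulrAC ler_pdivlMr ?normr_gt0// -normrM.
have {H} : (z ord0 (rshift 1 j) - z' ord0 (rshift 1 j)) * w ord0 j =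
    - \sum_(i < n | i != j) (z ord0 (rshift 1 i) - z' ord0 (rshift 1 i)) * w ord0 i.
  move: H => /eqP; rewrite /dot (bigD1 j)//= addr_eq0 => /eqP; rewrite !mxE => ->.
  by congr (- _); apply: eq_bigr => i _; rewrite !mxE.
move=> ->; rewrite normrN (le_trans (ler_norm_sum _ _ _))// mulr_suml.
rewrite [leRHS](bigD1 j)//= ler_wpDl ?mulr_ge0 ?(ltW h0)//.
apply: ler_sum => i ij; rewrite normrM mulrC ler_wpM2l//; apply: zz'.
by rewrite (@eq_rshift 1 n).
Qed.

(** Moving by minus the [k]-th normal lowers the flow by at least [lambda k], since
    [dot y (normal R v k) >= lambda k] on [P]; the subgradient inequality then gives
    [ell v lambda k (tl Q) >= 0]. *)
Lemma subdiff_flow_polytope (u : 'rV[R]_n -> \bar R) g z Q :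
  subdiff (fun z => flow P u g (hd z) (tl z)) z Q -> P (tl Q).
Proof.
move=> /subdiff_flow[F [zF H]] k.
have zF' : (flow P u g (hd z) (tl z) <= F%:E)%E by rewrite zF.
have : (flow P u g (hd z) (tl z - normal R v k) <= (F - lambda k)%:E)%E.
  apply: flow_shift zF' _ => y Py.
  have := Py k; rewrite /ell [tl z - _]addrC addrK -(scaleN1r (normal R v k)) dotZl dotC; lra.
move=> /(le_trans (H _ _)).
rewrite lee_fin [tl z - _]addrC addrK -(scaleN1r (normal R v k)) dotZr /ell; lra.
Qed.

End Polytope.

Lemma smooth_up_to_continuous (R : realType) (n : nat) (A : set 'rV[R]_n)
    (g : 'rV[R]_n -> R) : smooth_up_to A g ->
  exists2 h : 'rV[R]_n -> R, {in A, g =1 h} & {in A, continuous h}.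
Proof.
move=> [U [h [oU AU hs gh]]]; exists h => // y /set_mem Ay.
by have [+ _] := hs 0%N; apply; apply/mem_set/AU.
Qed.

(** * Boundedness and semicontinuity up to the boundary *)

Section CompactDomain.
Variables (R : realType) (n : nat) (A : set 'rV[R]_n) (g : 'rV[R]_n -> R).
Hypothesis gs : smooth_up_to A g.

Lemma smooth_up_to_bounded : compact A -> exists M, forall y, A y -> `|g y| <= M.
Proof.
have [h gh ch] := smooth_up_to_continuous gs => cA.
have /compact_bounded/pinfty_ex_gt0[M _ HM] :=
  continuous_compact (continuous_in_subspaceT ch) cA.
exists M => y Ay; rewrite gh ?inE//; apply: HM; by exists y.
Qed.

Lemma smooth_up_to_usc q e : A q -> 0 < e -> exists2 delta, 0 < delta &
  forall y, A y -> (forall i, `|y ord0 i - q ord0 i| < delta) -> g y <= g q + e.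
Proof.
have [h gh ch] := smooth_up_to_continuous gs => Aq e0.
have /cvgrPdist_lt/(_ _ e0)/nbhs_ballP[/= r r0 Hr] := ch q (mem_set Aq).
exists r => // y Ay yq.
have /Hr /= : ball q r y by split=> // i j; rewrite ord1 /ball/= distrC; exact: yq.
by rewrite !gh ?inE// ltr_norml; lra.
Qed.

End CompactDomain.

(** * Inclusion up to null sets *)

Theorem proposition3 (R : realType) (n d : nat)
    (v : 'I_d -> 'rV[int]_n) (lambda : 'I_d -> R) (c : R)
    (psi0 psidot0 udot0 : 'rV[R]_n -> R)
    (hdata : toric_cauchy_data v lambda c psi0 psidot0 udot0)
    (T : R) (hT : 0 < T) :
  let P := polytope v lambda in
  let psi := fun z : 'rV[R]_(1 + n) =>
    legendre_flow v lambda psi0 udot0 (hd z) (tl z) in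
  (MA psi [set z : 'rV[R]_(1 + n) | (0 <= hd z <= T)%R] <=
   volume (epi P (fun y => - (udot0 y)%:E) `\`
           epi P (fun y => - biconjugate P (EFin \o udot0) y)))%E.
Proof.
cbv zeta; set P := polytope v lambda.
have [delz _ psi0s psi0H [[_ _ grad_surj] _ _] _ _ gs _] := hdata.
have [Pbnd _ _ prim _] := delz.
have [M gM] : exists M, forall y, P y -> `|udot0 y| <= M.
  by apply: smooth_up_to_bounded gs _; apply: bounded_closed_compact Pbnd _;
    exact: polytope_closed.
set G := biconjugate P (EFin \o udot0).
(* The erosions of radius [1 / (i + 1)] exhaust the interior, so the sets [graph i] cover the part
   of the graph lying over it. *)
pose graph (i : nat) := [set z : 'rV[R]_(1 + n) |
  erosion P i.+1%:R^-1 (tl z) /\ G (tl z) = (- hd z)%:E].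
pose facet (i : nat) : set 'rV[R]_(1 + n) :=
  if insub i is Some k then [set z | ell v lambda k (tl z) = 0] else set0.
have graph0 i : volume (graph i) = 0%E.
  by apply: (volume_biconjugate_graph_erosion gM); rewrite invr_gt0.
have facet0 i : volume (facet i) = 0%E.
  rewrite /facet; case: insubP => [k _ _|_].
    (* A zero normal would equal [2 *: 0], against primitivity. *)
    apply: volume_facet_cylinder; apply/eqP => vk0.
    by have := prim k 2%Z 0; rewrite scaler0 => /(_ vk0).
  by apply: (@volume_bounded_lipschitz_coord R n ord0 0 (lexx 0) set0 0) => // ? [].
set S := (X in (_ <= volume X)%E).
(* Adjoining both exceptional families to [S] does not increase its volume, so a set inclusion
   remains to be shown. *)
apply: le_trans (volume_setU_null _ (volume_bigcup0 graph0)).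
apply: le_trans (volume_setU_null _ (volume_bigcup0 facet0)).
apply: volume_mono => Q [z /= /andP[z0 _] zQ].
have PQ : P (tl Q) by exact: subdiff_flow_polytope zQ.
have [pos|/existsNP[k /negP]] := pselect (forall k, 0 < ell v lambda k (tl Q)); last first.
  rewrite -leNgt => le0; right; exists (val k) => //.
  by rewrite /facet valK /=; apply/eqP; rewrite eq_le le0 PQ.
left.
have Pint : P° (tl Q) by exact: polytope_interior.
have [x0 _ qE] := grad_surj _ Pint.
have Pq : P (grad psi0 x0) by rewrite qE.
have up : - hd Q <= udot0 (tl Q).
  have := z0; rewrite le_eqVlt => /predU1P[z00|zpos]; last first.
    by have := subdiff_flow_pos psi0s psi0H Pq (esym qE) zpos zQ; rewrite qE.
  have gub y : P y -> udot0 y <= M by move=> /gM; rewrite ler_norml => /andP[].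
  have usc e := @smooth_up_to_usc _ _ _ _ gs _ e Pq.
  by have := subdiff_flow_zero psi0s psi0H Pq (esym qE) (esym z00) gub usc zQ; rewrite qE.
have := subdiff_flow_biconjugate_le zQ; rewrite -/G le_eqVlt => /predU1P[GE|Glt].
  right; have [r /= r0 Hr] := (nbhs_ballP _ _).1 Pint.
  (* This index makes the erosion radius smaller than the radius [r] of a ball around [tl Q] inside
     [P]. *)
  exists (Num.truncn r^-1) => //; split => // y yq.
  apply: Hr; split=> // i j; rewrite ord1 /ball/= distrC (le_lt_trans (yq j))//.
  by rewrite invf_plt ?posrE// truncnS_gt.
left; split.
  by split=> //; rewrite -EFinN lee_fin lerNl.
by move=> [_ ]; rewrite leeNl leNgt => /negP; apply.
Qed.
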